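(* Let a countable group $G$ act by measure-preserving transformations on a Lebesgue space $(X,\Sigma,\mu)$, and assume that the action is absolutely non-free. Then for every $n\in\mathbb N$, $n\ge 1$, the action $\mathrm{diag}_n$ of $G$ on $(X^n_{\mathrm{Sym}},\Sigma^n_{\mathrm{Sym}},\mu^n_{\mathrm{Sym}})$ is perfectly non-free.
   Context: A Lebesgue space is a standard probability space. For a measure-preserving automorphism $g$ of $X$ put $\mathrm{Fix}(g)=\{x: gx=x\}$ and $\mathrm{supp}(g)=X\setminus\mathrm{Fix}(g)$ (defined modulo null sets). Absolutely non-free: an action of a group $G$ on a measure space $(X,\Sigma,\mu)$ is absolutely non-free if for every measurable set $A$ and every $\epsilon>0$ there exists $g\in G$ with $\mu(\mathrm{Fix}(g)\,\Delta\, A)<\epsilon$. Perfectly non-free: a measure-preserving action of a countable group $G$ on a Lebesgue space $(Y,\Sigma_Y,\lambda)$ is perfectly non-free if there is a collection $\mathcal A$ of measurable subsets of $Y$ such that $\mathcal A$ together with the sets of measure zero generates $\Sigma_Y$, and for each $A\in\mathcal A$ the orbit $\{gy:g\in G_A\}$ is infinite for $\lambda$-almost all $y\in A$, where $G_A=\{g\in G:\lambda(\mathrm{supp}(g)\setminus A)=0\}$. Symmetrized diagonal action: $(X^n,\Sigma^n,\mu^n)$ is the $n$-th Cartesian power of $(X,\Sigma,\mu)$, and $G$ acts on it by $\mathrm{diag}_n(g)(x_1,\dots,x_n)=(gx_1,\dots,gx_n)$. This commutes with the action of the symmetric group $\mathrm{Sym}(n)$ permuting the factors, so it descends to an action, also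 denoted $\mathrm{diag}_n$, on the quotient $X^n_{\mathrm{Sym}}=X^n/\mathrm{Sym}(n)$. The quotient carries the sigma-algebra $\Sigma^n_{\mathrm{Sym}}$ of its measurable subsets and the invariant measure $\mu^n_{\mathrm{Sym}}$, the projection of $\mu^n$ under the quotient map. *)

(* Defs.v *)
From HB Require Import structures.
From mathcomp Require Import all_boot all_order all_algebra all_fingroup.
From mathcomp Require Import generic_quotient.
From mathcomp Require Import all_classical all_reals all_analysis.

Set Implicit Arguments.
Unset Strict Implicit.
Unset Printing Implicit Defensive.

Local Open Scope classical_set_scope.
Local Open Scope quotient_scope.

(* A standard Borel space: [phi] is an isomorphism of measurable spaces from
   [X] onto a Borel subset of the Polish space [S].  The image [phi @` setT] is
   Borel by the last clause, taken at [A = setT].  A Hausdorff pseudometric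
   space is a metric space.  A Lebesgue space is a standard Borel space [X]
   with a [probability X R]. *)
Definition standard_borel (R : realType) d (X : measurableType d) : Prop :=
  exists (S : completePseudoMetricType R) (phi : X -> S),
    [/\ hausdorff_space S,
        exists2 D : set S, countable D & dense D,
        injective phi,
        forall B : set S, <<s open >> B -> measurable (phi @^-1` B) &
        forall A : set X, measurable A -> <<s open >> (phi @` A)].

Record mp_action (R : realType) (G : groupType) d (X : measurableType d)
    (mu : probability X R) (act : G -> X -> X) : Prop := {
  mp_action1 : forall x, act 1%g x = x ;
  mp_actionM : forall g h x, act (g * h)%g x = act g (act h x) ;
  mp_action_measurable : forall g, measurable_fun [set: X] (act g) ;
  mp_action_preserving : forall g (A : set X), measurable A ->
    mu (act g @^-1` A) = mu A }.

Definition Fix (G X : Type) (act : G -> X -> X) (g : G) : set X :=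
  [set x | act g x = x].

Definition supp (G X : Type) (act : G -> X -> X) (g : G) : set X :=
  ~` Fix act g.

(* [A `+` B] is the symmetric difference.  [Fix act g] is measurable as soon as
   [X] is a standard Borel space and [act g] is measurable. *)
Definition absolutely_nonfree (R : realType) (G : groupType) d
    (X : measurableType d) (mu : probability X R) (act : G -> X -> X) : Prop :=
  forall A : set X, measurable A -> forall e : R, (0 < e)%R ->
    exists g : G, (mu (Fix act g `+` A) < e%:E)%E.

Definition local_group (R : realType) (G : groupType) d
    (Y : measurableType d) (nu : probability Y R) (act : G -> Y -> Y)
    (A : set Y) : set G :=
  [set g | nu (supp act g `\` A) = 0%E].

Record perfectly_nonfree (R : realType) (G : groupType) d
    (Y : measurableType d) (nu : probability Y R) (act : G -> Y -> Y) : Prop := {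
  perfectly_nonfree_countable : countable [set: G] ;
  perfectly_nonfree_lebesgue : standard_borel R Y ;
  perfectly_nonfree_mp : mp_action nu act ;
  perfectly_nonfree_family : exists F : set (set Y),
    [/\ F `<=` measurable,
        <<s F `|` [set N | measurable N /\ nu N = 0%E] >> = measurable &
        forall A, F A -> {ae nu, forall y, A y ->
          infinite_set [set act g y | g in local_group nu act A]}] }.

Section sym_power.
Context (n : nat) (T : choiceType).

Definition permute_tuple (s : 'S_n) (x : n.-tuple T) : n.-tuple T :=
  [tuple tnth x (s i) | i < n].

Definition sym_rel (x y : n.-tuple T) : bool :=
  [exists s : 'S_n, x == permute_tuple s y].

Lemma sym_relE (x y : n.-tuple T) : sym_rel x y = perm_eq x y.
Proof.
apply/existsP/tuple_permP => [[s /eqP ->]|[s e]]; first by exists s.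
by exists s; apply/eqP/val_inj.
Qed.

Let sym_rel_refl : reflexive sym_rel.
Proof. by move=> x; rewrite sym_relE. Qed.

Let sym_rel_sym : symmetric sym_rel.
Proof. by move=> x y; rewrite !sym_relE perm_sym. Qed.

Let sym_rel_trans : transitive sym_rel.
Proof. by move=> y x z; rewrite !sym_relE; exact: perm_trans. Qed.

Definition sym_equiv := EquivRel sym_rel sym_rel_refl sym_rel_sym sym_rel_trans.

Definition sym_power : Type := {eq_quot sym_equiv}.

HB.instance Definition _ := Choice.on sym_power.
HB.instance Definition _ := EqQuotient.on sym_power.

End sym_power.

HB.instance Definition _ n (T : pointedType) :=
  isPointed.Build (sym_power n T) (\pi [tuple point | i < n]).

Definition sym_proj n (T : choiceType) (x : n.-tuple T) : sym_power n T :=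
  \pi x.

Lemma sym_projP n (T : choiceType) (x y : n.-tuple T) :
  sym_proj x = sym_proj y <-> exists s : 'S_n, x = permute_tuple s y.
Proof.
split=> [/eqmodP /existsP[s /eqP ->]|[s ->]]; first by exists s.
by apply/eqmodP/existsP; exists s.
Qed.

Definition sym_display : measure_display -> measure_display.
Proof. exact. Qed.

Section sym_power_measurable.
Context (n : nat) d (T : measurableType d).

Definition sym_measurable : set (set (sym_power n T)) :=
  [set A | measurable (@sym_proj n T @^-1` A)].

Let sym_measurable0 : sym_measurable set0.
Proof. by rewrite /sym_measurable /= preimage_set0. Qed.

Let sym_measurableC A : sym_measurable A -> sym_measurable (~` A).
Proof. by rewrite /sym_measurable /= preimage_setC; exact: measurableC. Qed.

Let sym_measurable_bigcup (F : (set (sym_power n T))^nat) :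
  (forall i, sym_measurable (F i)) -> sym_measurable (\bigcup_i F i).
Proof.
move=> mF; rewrite /sym_measurable /= preimage_bigcup.
by apply: bigcup_measurable => i _; exact: mF.
Qed.

HB.instance Definition _ := @isMeasurable.Build (sym_display d)
  (sym_power n T) sym_measurable sym_measurable0 sym_measurableC
  sym_measurable_bigcup.

Lemma measurable_sym_proj : measurable_fun [set: n.-tuple T] (@sym_proj n T).
Proof. by move=> _ A mA; rewrite setTI. Qed.

HB.instance Definition _ :=
  isMeasurableFun.Build _ _ _ _ (@sym_proj n T) measurable_sym_proj.

End sym_power_measurable.

Definition cons_pair n T (p : T * n.-tuple T) : n.+1.-tuple T :=
  [the n.+1.-tuple T of p.1 :: p.2].

Section cons_pair_measurable.
Context (n : nat) d (T : measurableType d).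

Lemma measurable_cons_pair :
  measurable_fun [set: T * n.-tuple T] (@cons_pair n T).
Proof. exact: (measurable_cons measurable_fst measurable_snd). Qed.

HB.instance Definition _ :=
  isMeasurableFun.Build _ _ _ _ (@cons_pair n T) measurable_cons_pair.

End cons_pair_measurable.

(* Built by recursion from the binary product measure; [power_probE] is the
   characteristic property. *)
Fixpoint power_prob (R : realType) d (X : measurableType d)
    (mu : probability X R) n : probability (n.-tuple X) R :=
  match n with
  | 0 => dirac [tuple]
  | m.+1 => distribution (mu \x power_prob mu m)%E (@cons_pair m X)
  end.

Lemma power_probE (R : realType) d (X : measurableType d)
    (mu : probability X R) n (A : 'I_n -> set X) :
  (forall i, measurable (A i)) ->
  power_prob mu n [set x | forall i, A i (tnth x i)] =
    (\prod_(i < n) mu (A i))%E.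
Proof.
elim: n A => [|n IH] A mA.
  rewrite big_ord0 /= diracE mem_set//= => -[].
  by [].
rewrite big_ord_recl /= /distribution /pushforward.
have -> : @cons_pair n X @^-1` [set x | forall i, A i (tnth x i)] =
    A ord0 `*` [set x | forall i, A (lift ord0 i) (tnth x i)].
  apply/seteqP; split=> -[a x] /=.
    move=> h; split; first exact: (h ord0).
    by move=> i; have := h (lift ord0 i); rewrite tnthS.
  move=> [/= a0 h] i; case: (unliftP ord0 i) => [j ->|->]; last exact: a0.
  by rewrite tnthS; exact: h.
have mB : measurable [set x : n.-tuple X | forall i, A (lift ord0 i) (tnth x i)].
  have -> : [set x : n.-tuple X | forall i, A (lift ord0 i) (tnth x i)] =
      \bigcap_(i in [set: 'I_n]) ((@tnth n X)^~ i @^-1` A (lift ord0 i)).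
    by apply/seteqP; split=> x /= h i => [_|]; exact: h.
  apply: fin_bigcap_measurable => [|i _]; first exact: finite_finset.
  by rewrite -[X in measurable X]setTI; exact: measurable_tnth.
rewrite product_measure1E//; congr (_ * _)%E; exact: IH.
Qed.

Definition sym_power_prob (R : realType) d (X : measurableType d)
    (mu : probability X R) n : probability (sym_power n X) R :=
  distribution (power_prob mu n) (@sym_proj n X).

Definition diag n (G X : Type) (act : G -> X -> X) (g : G) (x : n.-tuple X) :
  n.-tuple X := [tuple act g (tnth x i) | i < n].

(* Defined on representatives; [sym_diag_proj] shows that it is the action
   induced by [diag]. *)
Definition sym_diag n (G : Type) (X : choiceType) (act : G -> X -> X) (g : G)
  (q : sym_power n X) : sym_power n X := sym_proj (diag act g (repr q)).

Lemma sym_diag_proj n (G : Type) (X : choiceType) (act : G -> X -> X) (g : G)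
    (x : n.-tuple X) :
  sym_diag act g (sym_proj x) = sym_proj (diag act g x).
Proof.
have /sym_projP[s e] : sym_proj (repr (sym_proj x)) = sym_proj x.
  exact: reprK.
apply/sym_projP; exists s; rewrite e; apply: eq_from_tnth => i.
by rewrite !tnth_mktuple.
Qed.

(* Main.v *)
From HB Require Import structures.
Require Import Defs.
From mathcomp Require Import all_boot all_order all_algebra all_fingroup.
From mathcomp Require Import generic_quotient.
From mathcomp Require Import all_classical all_reals all_analysis.

(** Why the symmetrized diagonal action is perfectly non-free.

    For a measurable set [B] of [X], [meets B] is the set of multisets with at
    least one point in [B].  An element of [G] supported in [B] fixes every
    multiset that avoids [B], so the local group of [B] in [X] is contained in
    the local group of [meets B] in the symmetric power
    ([local_group_meets]), and a multiset has an infinite orbit as soon as one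
    of its points has one.  It is therefore enough to find many sets [C] in [X]
    such that almost every point of [C] has an infinite orbit under the local
    group of [C]; the family of the theorem consists of the sets [meets C].

    Absolute non-freeness only gives elements whose support is close to a
    given set, not contained in it, so such sets [C] have to be built.  Fix a
    sequence [D k] of measurable sets that isolates every point from every
    finite set.  Given [B] and [e], choose for all [k] and [j] an element
    [g k j] whose support differs from [D k `&` B] by a set of tiny
    measure, and enlarge [B] by all these supports; the measure added is
    at most [e] ([local_orbit_step]).  For fixed [k], almost every point [x] of
    [D k `&` B] is moved by some [g k j] to another point of [D k], because
    the exceptional set has measure at most a multiple of [1/j.+1] for all
    [j].  If the orbit of [x] were finite, some [D k] would contain [x] and no
    other point of the orbit, a contradiction.  The enlarged set may contain new
    points with finite orbits, but iterating the enlargement and taking the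
    union yields a set [C] containing [B], with [C \ B] of measure at most [e],
    almost all of whose points have infinite orbits under the local group of
    [C] ([locally_infinite_hull]).

    Letting [e] tend to 0 shows that, modulo null sets, the family generates
    every [meets B].  These sets generate everything.  If [A 1], ..., [A n] are
    disjoint, then the multisets with one point in each [A i] are the
    intersection of the sets [meets (A i)], and the quotient map is injective
    on the box [A 1 * ... * A n]; hence the images of all measurable parts of
    the box are generated ([sym_proj_box_generated]).  Countably many disjoint
    boxes built from the [D k] cover the tuples with distinct entries.  The
    other tuples form a null set, because [mu] has no atoms: an element whose
    support was close to an atom [{a}] would also have to move the image of
    [a], which is an atom of the same mass
    ([absolutely_nonfree_nonatomic]).

    The symmetric power is a standard Borel space because the quotient map has
    a Borel transversal: order [X] lexicographically by the indicators of the
    sets [D k] and keep the sorted tuples ([measurable_transversal]). *)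

Set Implicit Arguments.
Unset Strict Implicit.
Unset Printing Implicit Defensive.
Import Order.TTheory GRing.Theory Num.Theory.
Local Open Scope ring_scope.
Local Open Scope classical_set_scope.

(** * Images and preimages of generated sigma-algebras *)

(** Injectivity on [Q] makes the image commute with complements relative to
    [Q], so that the sets with good image form a sigma-algebra. *)
Lemma sigma_algebra_image_inj (T Y : Type) (f : T -> Y) (Q : set T)
    (C : set (set T)) (S : set (set Y)) :
  sigma_algebra [set: Y] S ->
  (forall x y, Q x -> Q y -> f x = f y -> x = y) ->
  S (f @` Q) -> (forall E, C E -> S (f @` (E `&` Q))) ->
  forall E, <<s C >> E -> S (f @` (E `&` Q)).
Proof.
move=> [S0 SC SU] finj SQ SCQ.
have SI A B : S A -> S B -> S (A `&` B).
  move=> SA SB; rewrite -[A `&` B]setCK setCI -bigcup2E -setTD.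
  by apply: (SC); apply: SU => -[|[|k]] //=; rewrite -setTD; exact: SC.
apply: smallest_sub => //; split=> [|A SA|A SA].
- by rewrite set0I image_set0.
- have -> : f @` ((setT `\` A) `&` Q) = f @` Q `&` (setT `\` f @` (A `&` Q)).
    rewrite !setTD; apply/seteqP; split=> [_ [x [nAx Qx] <-]|_ [[x Qx <-] nA]].
      split; first by exists x.
      by move=> [y [Ay Qy]] /(finj _ _ Qy Qx) yx; apply: nAx; rewrite -yx.
    by exists x => //; split=> // Ax; apply: nA; exists x.
  by apply: SI => //; exact: SC.
- by rewrite setI_bigcupl image_bigcup; exact: SU.
Qed.

Lemma sigma_algebra_preimage (T U : Type) (f : T -> U) (C : set (set U))
    (M : set (set T)) :
  sigma_algebra [set: T] M -> (forall B, C B -> M (f @^-1` B)) ->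
  forall B, <<s C >> B -> M (f @^-1` B).
Proof.
move=> [M0 MC MU] CM; apply: smallest_sub => //; split=> [|B|B MB].
- by rewrite preimage_set0.
- by move=> MB; rewrite setTD preimage_setC -setTD; exact: MC.
- by rewrite preimage_bigcup; exact: MU.
Qed.

Lemma measurable_preimage d d' (T : measurableType d) (U : measurableType d')
    (f : T -> U) (A : set U) :
  measurable_fun setT f -> measurable A -> measurable (f @^-1` A).
Proof. by move=> mf mA; have := mf measurableT A mA; rewrite setTI. Qed.

(** * Separating sequences of measurable sets *)

Definition open_base (S : topologicalType) (b : nat -> set S) :=
  (forall k, open (b k)) /\
  forall x U, nbhs x U -> exists2 k, b k x & b k `<=` U.

(** Balls of a pseudometric space need not be open, hence the interiors. *)
Lemma separable_open_base (R : realType) (S : pseudoMetricType R)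
    (q : nat -> S) : dense (range q) -> exists b : nat -> set S, open_base b.
Proof.
move=> qdense.
exists (fun k => if unpickle k is Some (i, j) then
  interior (ball (q i) (j.+1%:R^-1 : R)%R) else set0); split.
  move=> k; case: (unpickle k) => [[i j]|]; [exact: open_interior|exact: open0].
move=> x U /nbhs_ballP[e /= e0 xeU].
have [j jP] : exists j : nat, (j.+1%:R^-1 < e / 2 :> R)%R.
  have [j] := ltr_add_invr (divr_gt0 e0 (@ltr0Sn R 1)).
  by rewrite add0r; exists j.
have j0 : (0 < j.+1%:R^-1 / 2 :> R)%R by rewrite divr_gt0 // invr_gt0.
have [z [xz [i _ iz]]] :
    interior (ball x (j.+1%:R^-1 / 2 : R)%R) `&` range q !=set0.
  apply: qdense; last exact: open_interior.
  by exists x; apply: nbhs_singleton; apply: nbhs_interior; exact: nbhsx_ballx.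
have xqi : ball x (j.+1%:R^-1 / 2)%R (q i).
  by rewrite iz; exact: interior_subset.
exists (pickle (i, j)); rewrite pickleK.
  rewrite /interior /=; apply/nbhs_ballP; exists (j.+1%:R^-1 / 2)%R => //= y xy.
  by rewrite [X in ball _ X](splitr (j.+1%:R^-1)%R);
    apply: ball_triangle xy; exact: ball_sym.
move=> y /interior_subset qy; apply: xeU.
rewrite (splitr e); apply: ball_triangle (_ : ball (q i) _ _).
  apply: le_ball xqi; apply: le_trans (ltW jP).
  by rewrite ler_pdivrMr// ler_peMr// ?ler1n// invr_ge0.
by apply: le_ball qy; exact: ltW.
Qed.

(** Isolating a point from a finite set, and not only from one other point, is
    what a finite orbit has to be confronted with. *)
Definition point_separating (X : Type) (D : nat -> set X) :=
  forall x (O : set X), finite_set O -> ~ O x ->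
    exists2 k, D k x & forall y, O y -> ~ D k y.

(** A dense sequence replaces the countable dense set: the Polish space is
    nonempty because it is pointed. *)
Lemma standard_borelP (R : realType) d (X : measurableType d) :
  standard_borel R X ->
  exists (S : completePseudoMetricType R) (phi : X -> S) (q : nat -> S),
  [/\ hausdorff_space S, dense (range q), injective phi,
      forall B, <<s open >> B -> measurable (phi @^-1` B) &
      forall A, measurable A -> <<s open >> (phi @` A)].
Proof.
move=> [S [phi [hS [D Dc Dd] phi_inj phi_m phi_im]]].
have /pfcard_geP[D0|[q]] := Dc.
  have [x [_]] := Dd setT (ex_intro _ point I) openT.
  by rewrite D0.
exists S, phi, q; split=> //.
by rewrite (image_eq q).
Qed.

Lemma standard_borel_separating (R : realType) d (X : measurableType d) :
  standard_borel R X ->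
  exists D : nat -> set X, (forall k, measurable (D k)) /\ point_separating D.
Proof.
move=> /standard_borelP[S [phi [q [hS /separable_open_base[b [bo bP]]]]]].
move=> phi_inj phi_m _.
exists (fun k => phi @^-1` b k); split=> [k|x O Ofin nOx].
  by apply: phi_m; exact: sub_sigma_algebra.
have /(bP (phi x))[k bx bO] : nbhs (phi x) (~` (phi @` O)).
  apply: open_nbhs_nbhs; split; last first.
    by move=> [y Oy /phi_inj yx]; apply: nOx; rewrite -yx.
  have /accessible_finite_set_closed closed_fin := hausdorff_accessible hS.
  by rewrite openC; apply: closed_fin; exact: finite_image.
by exists k => // y Oy /bO; apply; exists y.
Qed.

Lemma point_separating_neq (X : Type) (D : nat -> set X) : point_separating D ->
  forall x y, x <> y -> exists2 k, D k x & ~ D k y.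
Proof.
move=> sD x y xy; have [|k Dx nD] := sD x [set y] (finite_set1 y).
  by move=> /= /xy.
by exists k => //; exact: nD.
Qed.

(** A point [x] is moved exactly when some [D k] contains [x] but not its
    image. *)
Lemma measurable_supp (G : Type) d (X : measurableType d) (act : G -> X -> X)
    (D : nat -> set X) (g : G) :
  (forall k, measurable (D k)) -> point_separating D ->
  measurable_fun setT (act g) -> measurable (supp act g).
Proof.
move=> mD /point_separating_neq sD mg.
have -> : supp act g = \bigcup_k (D k `&` act g @^-1` (~` D k)).
  apply/seteqP; split=> [x gx|x [k _ [/= Dx nDgx]] gx].
    by have [k Dx nD] := sD x (act g x) (fun e => gx (esym e)); exists k.
  by apply: nDgx; rewrite gx.
apply: bigcup_measurable => k _; apply: measurableI => //.
by apply: measurable_preimage mg _; exact: measurableC.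
Qed.

(** * Measurability on finite powers *)

Definition coord_preimages n d (X : measurableType d) :
    set (set (n.-tuple X)) :=
  [set E | exists (i : 'I_n) (A : set X),
    measurable A /\ E = [set x | A (tnth x i)]].

Lemma measurable_tuple_gen n d (X : measurableType d) (E : set (n.-tuple X)) :
  measurable E -> <<s @coord_preimages n d X >> E.
Proof.
move: E; apply: smallest_sub; first exact: smallest_sigma_algebra.
apply: (big_ind (fun C : set (set (n.-tuple X)) =>
    C `<=` <<s @coord_preimages n d X >>)) => //.
  by move=> C C' CS C'S E [/CS|/C'S].
move=> i _ _ [A mA <-]; apply: sub_sigma_algebra; exists i, A.
by rewrite setTI.
Qed.

Lemma measurable_coord n d (X : measurableType d) (i : 'I_n) (A : set X) :
  measurable A -> measurable [set x : n.-tuple X | A (tnth x i)].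
Proof.
exact: measurable_preimage (measurable_tnth i).
Qed.

Lemma measurable_map_coord n d (X : measurableType d) (s : 'I_n -> 'I_n)
    (g : X -> X) : measurable_fun setT g ->
  measurable_fun setT (fun x : n.-tuple X => [tuple g (tnth x (s i)) | i < n]).
Proof.
move=> mg; apply/measurable_fun_tnthP => i.
rewrite (_ : _ \o _ = g \o (@tnth n X)^~ (s i)); last first.
  by apply/funext => x /=; rewrite tnth_mktuple.
by apply: measurableT_comp => //; exact: measurable_tnth.
Qed.

(** * A measurable transversal of the symmetric power *)

Section lexicographic_order.
Context (X : Type) (D : nat -> set X).

(** The lexicographic order on the sequences of indicators of the [D k].  It is
    linear once the [D k] separate points, and it is a Borel relation, which
    makes sorting a measurable operation. *)
Definition lexlt (x y : X) := exists k,
  [/\ forall l, (l < k)%N -> (D l x <-> D l y), ~ D k x & D k y].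

Definition lexle (x y : X) : bool := `[< ~ lexlt y x >].

Lemma lexlt_trans x y z : lexlt x y -> lexlt y z -> lexlt x z.
Proof.
move=> [k [kl kx ky]] [m [ml my mz]].
have [km|mk|km] := ltngtP k m.
- exists k; split=> // [l lk|]; last by apply/(ml k km).
  by rewrite (kl l lk); apply: ml; exact: ltn_trans km.
- exists m; split=> // [l lm|/(kl m mk)//].
  by rewrite -(ml l lm); apply: kl; exact: ltn_trans mk.
- by rewrite km in ky.
Qed.

Lemma lexlt_irr x : ~ lexlt x x.
Proof. by move=> [k []]. Qed.

Lemma lexle_total : total lexle.
Proof.
move=> x y; have [//|] := boolP (lexle x y).
move=> /asboolPn /contrapT xy; apply/asboolP => yx.
by apply: (@lexlt_irr x); exact: lexlt_trans yx xy.
Qed.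

Hypothesis D_separating : point_separating D.

Lemma lexlt_trichotomy x y : [\/ x = y, lexlt x y | lexlt y x].
Proof.
have [->|xy] := pselect (x = y); first by constructor 1.
have Dxy : exists k, `[< ~ (D k x <-> D k y) >].
  have [k Dx nDy] := point_separating_neq D_separating xy.
  by exists k; apply/asboolP => -[/(_ Dx)].
case: (ex_minnP Dxy) => k /asboolP kxy kmin.
have kl l : (l < k)%N -> (D l x <-> D l y).
  move=> lk; apply: contrapT => /asboolP /kmin.
  by rewrite leqNgt lk.
have [Dx|nDx] := pselect (D k x); have [Dy|nDy] := pselect (D k y).
- by exfalso; apply: kxy.
- by constructor 3; exists k; split=> // l /kl ->.
- by constructor 2; exists k.
- by exfalso; apply: kxy.
Qed.

Lemma lexle_anti : antisymmetric lexle.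
Proof.
by move=> x y /andP[/asboolP yx /asboolP xy]; case: (lexlt_trichotomy x y).
Qed.

Lemma lexle_trans : transitive lexle.
Proof.
move=> y x z /asboolP yx /asboolP zy; apply/asboolP => zx.
have [xy|xy|//] := lexlt_trichotomy x y; first by rewrite xy in zx.
by apply: zy; exact: lexlt_trans xy.
Qed.

End lexicographic_order.

Lemma measurable_lexlt_coord n d (X : measurableType d) (D : nat -> set X)
    (i j : 'I_n) : (forall k, measurable (D k)) ->
  measurable [set x : n.-tuple X | lexlt D (tnth x i) (tnth x j)].
Proof.
move=> mD; pose E (l : nat) (i : 'I_n) := [set x : n.-tuple X | D l (tnth x i)].
have mE l i' : measurable (E l i') by exact: measurable_coord.
rewrite (_ : mkset _ = \bigcup_k ((\bigcap_l
  if (l < k)%N then (E l i `&` E l j) `|` (~` E l i `&` ~` E l j) else setT)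
  `&` (~` E k i `&` E k j))).
  apply: bigcup_measurable => k _.
  apply: measurableI; last by apply: measurableI => //; exact: measurableC.
  apply: bigcapT_measurable => l; case: ifP => // _.
  by apply: measurableU; apply: measurableI => //; exact: measurableC.
apply/seteqP; split=> x /=.
  move=> [k [kl kx ky]]; exists k => //; split=> // l _.
  case: ifP => // lk; have [Dx|nDx] := pselect (E l i x); [left|right].
    by split=> //; apply/(kl l lk).
  by split=> // /(kl l lk).
move=> [k _ [kl [kx ky]]]; exists k; split=> // l lk.
by have := kl l I; rewrite lk => -[[? ?]|[? ?]]; split.
Qed.

(** The transversal consists of the sorted tuples: each multiset has exactly
    one sorted enumeration. *)
Lemma measurable_transversal n d (X : measurableType d) (D : nat -> set X) :
  (forall k, measurable (D k)) -> point_separating D ->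
  exists Tr : set (n.-tuple X),
    [/\ measurable Tr, forall y, exists2 x, Tr x & sym_proj x = y &
        forall x x', Tr x -> Tr x' -> sym_proj x = sym_proj x' -> x = x'].
Proof.
move=> mD sD; exists [set x : n.-tuple X | sorted (lexle D) x]; split.
- rewrite (_ : mkset _ = \bigcap_(ij in [set: 'I_n * 'I_n])
    if ij.2 == ij.1.+1 :> nat then
      ~` [set x : n.-tuple X | lexlt D (tnth x ij.2) (tnth x ij.1)]
    else setT).
    apply: fin_bigcap_measurable => [|[i j] _]; first exact: finite_finset.
    by case: ifP => //= _; apply: measurableC; exact: measurable_lexlt_coord.
  apply/seteqP; split=> x /=.
    move=> /(sortedP point) xs [i j] _ /=; case: ifP => // /eqP ji /=.
    have := xs i; rewrite size_tuple -ji ltn_ord => /(_ isT) /asboolP.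
    by rewrite -!tnth_nth.
  move=> xs; apply/(sortedP point) => i; rewrite size_tuple => iN.
  apply/asboolP; have := xs (Ordinal (ltnW iN), Ordinal iN) I.
  by rewrite /= eqxx /= !(tnth_nth point).
- move=> y; exists [tuple of sort (lexle D) (repr y)].
    by rewrite /=; apply: sort_sorted; exact: lexle_total.
  rewrite -[RHS]reprK; apply/eqmodP => /=.
  by rewrite /= sym_relE /= perm_sort.
- move=> x x' xs x's /eqmodP; rewrite /= sym_relE => xx'; apply/val_inj.
  by apply: sorted_eq xs x's xx'; [exact: lexle_trans|exact: lexle_anti].
Qed.

(** * The symmetric power of a standard Borel space *)

Section row_vectors.
Context (R : realType) (S : completePseudoMetricType R) (n : nat).

Lemma nbhs_row_coord (v : 'rV[S]_n) i A :
  nbhs (v ord0 i) A -> nbhs v [set w : 'rV[S]_n | A (w ord0 i)].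
Proof.
move=> /nbhs_ballP[e /= e0 eA]; apply/nbhs_ballP; exists e => //= w [_ vw].
by apply: eA; exact: vw.
Qed.

Lemma hausdorff_row : hausdorff_space S -> hausdorff_space 'rV[S]_n.
Proof.
move=> hS v w vw; apply/matrixP => i j; rewrite (ord1 i).
apply: hS => A B /nbhs_row_coord vA /nbhs_row_coord wB.
by have [u [Au Bu]] := vw _ _ vA wB; exists (u ord0 j).
Qed.

Lemma separable_row (q : nat -> S) : dense (range q) ->
  exists2 E : set 'rV[S]_n, countable E & dense E.
Proof.
move=> qd; exists (range (fun k : {ffun 'I_n -> nat} => (\row_i q (k i))%R)).
  by apply: card_le_trans (card_image_le _ _) _; exact: countableP.
move=> O [v Ov] oO.
have /nbhs_ballP[e /= e0 eO] : nbhs v O by exact: open_nbhs_nbhs.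
have /choice[k kP] : forall i, exists k, ball (v ord0 i) e (q k).
  move=> i; have [z [vz [k _ kz]]] :
      interior (ball (v ord0 i) e) `&` range q !=set0.
    apply: qd; last exact: open_interior.
    exists (v ord0 i); apply: nbhs_singleton; apply: nbhs_interior.
    exact: nbhsx_ballx.
  by exists k; rewrite kz; exact: interior_subset.
exists (\row_i q ([ffun i => k i] i))%R; split; last by exists [ffun i => k i].
apply: eO; split=> // i j; rewrite (ord1 i) mxE ffunE; exact: kP.
Qed.

(** The union is over a countable index type: this is why the Borel
    sigma-algebra of the power of a separable space is generated by boxes. *)
Lemma open_row_boxes (b : nat -> set S) (O : set 'rV[S]_n) :
  open_base b -> open O ->
  O = \bigcup_(k in [set k : {ffun 'I_n -> nat} |
        [set w : 'rV[S]_n | forall i, b (k i) (w ord0 i)] `<=` O])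
      [set w | forall i, b (k i) (w ord0 i)].
Proof.
move=> [bo bP] oO; apply/seteqP; split=> [v Ov|v [k kO]]; last exact: kO.
have /nbhs_ballP[e /= e0 eO] : nbhs v O by exact: open_nbhs_nbhs.
have /choice[k kP] : forall i, exists k, b k (v ord0 i) /\
    b k `<=` ball (v ord0 i) e.
  by move=> i; have [k ? ?] := bP _ _ (nbhsx_ballx (v ord0 i) e e0); exists k.
exists [ffun i => k i] => [w wk|i]; last by rewrite ffunE; exact: (kP i).1.
apply: eO; split=> // i j; rewrite (ord1 i); apply: (kP j).2.
by have := wk j; rewrite ffunE.
Qed.

End row_vectors.

Section tuple_embedding.
Context (R : realType) (S : completePseudoMetricType R) (n : nat) d
  (X : measurableType d) (phi : X -> S).
Hypothesis phi_inj : injective phi.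

Definition tuple_row (x : n.-tuple X) : 'rV[S]_n := (\row_i phi (tnth x i))%R.

Lemma tuple_row_inj : injective tuple_row.
Proof.
move=> x y /rowP xy; apply: eq_from_tnth => i; apply: phi_inj.
by have := xy i; rewrite !mxE.
Qed.

Lemma measurable_tuple_row (b : nat -> set S) (B : set 'rV[S]_n) :
  open_base b -> (forall C, <<s open >> C -> measurable (phi @^-1` C)) ->
  <<s open >> B -> measurable (tuple_row @^-1` B).
Proof.
move=> bP phi_m; apply: sigma_algebra_preimage.
  exact: sigma_algebra_measurable.
move=> O /(open_row_boxes bP) ->; rewrite preimage_bigcup.
rewrite bigcup_mkcond; apply: countable_bigcupT_measurable => // k.
case: ifP => // _.
rewrite (_ : _ @^-1` _ = \bigcap_(i in [set: 'I_n])
    [set x : n.-tuple X | (phi @^-1` b (k i)) (tnth x i)]).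
  apply: fin_bigcap_measurable => [|i _]; first exact: finite_finset.
  apply: measurable_coord; apply: phi_m; apply: sub_sigma_algebra.
  exact: bP.1.
apply/seteqP; split=> x /= xk i => [_|]; first by have := xk i; rewrite mxE.
by rewrite mxE; exact: xk.
Qed.

(** It is enough to treat the sets defined by one coordinate, whose image is
    cut out of the image of the whole space by one coordinate condition. *)
Lemma borel_tuple_row_image (E : set (n.-tuple X)) :
  (forall A, measurable A -> <<s open >> (phi @` A)) ->
  measurable E -> <<s open >> (tuple_row @` E).
Proof.
move=> phi_im /measurable_tuple_gen; rewrite -{2}[E]setIT.
have borel_coord (i : 'I_n) B : <<s open >> B ->
    <<s open >> [set v : 'rV[S]_n | B (v ord0 i)].
  apply: sigma_algebra_preimage; first exact: smallest_sigma_algebra.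
  move=> O oO; apply: sub_sigma_algebra; rewrite openE => v Ov.
  by apply: nbhs_row_coord; exact: open_nbhs_nbhs.
have borel_range : <<s open >>
    (\bigcap_(i in [set: 'I_n]) [set v : 'rV[S]_n | range phi (v ord0 i)]).
  apply: (@fin_bigcap_measurable _ (g_sigma_algebraType (@open 'rV[S]_n))).
    exact: finite_finset.
  by move=> i _; apply: borel_coord; exact: phi_im.
have rangeE : range tuple_row =
    \bigcap_(i in [set: 'I_n]) [set v : 'rV[S]_n | range phi (v ord0 i)].
  apply/seteqP; split=> [_ [x _ <-] i _ /=|v vP].
    by rewrite mxE; exists (tnth x i).
  have /choice[x xP] : forall i, exists x, phi x = v ord0 i.
    by move=> i; have [x _ <-] := vP i I; exists x.
  exists [tuple x i | i < n] => //.
  by apply/rowP => i; rewrite mxE tnth_mktuple.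
apply: sigma_algebra_image_inj.
- exact: smallest_sigma_algebra.
- by move=> x y _ _; exact: tuple_row_inj.
- by rewrite rangeE.
move=> _ [i [A [mA ->]]].
rewrite (_ : _ @` _ =
    [set v : 'rV[S]_n | (phi @` A) (v ord0 i)] `&` range tuple_row).
  rewrite rangeE.
  apply: (@measurableI _ (g_sigma_algebraType (@open 'rV[S]_n))) borel_range.
  by apply: borel_coord; exact: phi_im.
rewrite setIT; apply/seteqP; split=> [_ [x Ax <-]|v [[a Aa ai] [x _ xv]]].
  by split; [rewrite /= mxE; exists (tnth x i)|exists x].
exists x => //=; move: ai; rewrite -xv mxE => /phi_inj <-.
exact: Aa.
Qed.

End tuple_embedding.

Lemma sym_proj_surj n (T : choiceType) (y : sym_power n T) :
  exists x, sym_proj x = y.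
Proof. by exists (repr y); exact: reprK. Qed.

Lemma permute_sym_proj n (T : choiceType) (s : 'S_n) (x : n.-tuple T) :
  sym_proj (permute_tuple s x) = sym_proj x.
Proof. by apply/sym_projP; exists s. Qed.

(** A multiset is sent to the row of its representative in the transversal.
    The image of a set [A] is the image of the measurable set of the
    representatives of [A]; the preimage of a Borel set is measurable since its
    pullback to tuples is a union over the finitely many permutations. *)
Lemma standard_borel_sym_power (R : realType) d (X : measurableType d) n :
  standard_borel R X -> standard_borel R (sym_power n X).
Proof.
move=> sbX; have [D [mD sD]] := standard_borel_separating sbX.
have [Tr [mTr Tr_ex Tr_uniq]] := measurable_transversal n mD sD.
have [S [phi [q [hS qd phi_inj phi_m phi_im]]]] := standard_borelP sbX.
have [b bP] := separable_open_base qd.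
have /choice[sec secP] : forall y, exists x, Tr x /\ sym_proj x = y.
  by move=> y; have [x] := Tr_ex y; exists x.
exists 'rV[S]_n, (tuple_row phi \o sec); split.
- exact: hausdorff_row.
- exact: separable_row qd.
- move=> y y' /(tuple_row_inj phi_inj) yy'.
  by rewrite -(secP y).2 -(secP y').2 yy'.
- move=> B mB; rewrite /measurable /= /sym_measurable /=.
  rewrite (_ : _ @^-1` _ = \bigcup_(s in [set: 'S_n])
      permute_tuple s @^-1` (Tr `&` tuple_row phi @^-1` B)).
    apply: fin_bigcup_measurable => [|s _]; first exact: finite_finset.
    apply: measurable_preimage.
      exact: (@measurable_map_coord n _ X s id (@measurable_id _ X setT)).
    by apply: measurableI => //; exact: measurable_tuple_row bP _ _.
  apply/seteqP; split=> [x /= Bx|x [s _ [/= sTr sB]]].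
    have /sym_projP[s sx] := (secP (sym_proj x)).2.
    by exists s => //=; rewrite -sx; split => //; exact: (secP _).1.
  rewrite /= -(permute_sym_proj s x).
  rewrite (Tr_uniq (sec _) (permute_tuple s x)) //; first exact: (secP _).1.
  exact: (secP _).2.
- move=> A mA.
  rewrite (_ : _ @` A = tuple_row phi @` (Tr `&` @sym_proj n X @^-1` A)).
    by apply: borel_tuple_row_image => //; exact: measurableI.
  apply/seteqP; split=> [_ [y Ay <-]|_ [x [Tx Ax] <-]].
    exists (sec y) => //; split; first exact: (secP _).1.
    by rewrite /= (secP y).2.
  exists (sym_proj x) => //=; congr tuple_row.
  by apply: Tr_uniq => //; [exact: (secP _).1|exact: (secP _).2].
Qed.

(** * Powers of a probability measure *)

Lemma negligible_bigcup_countable d (T : measurableType d) (R : realType)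
    (mu : {measure set T -> \bar R}) (I : countType) (F : I -> set T) :
  (forall i, mu.-negligible (F i)) -> mu.-negligible (\bigcup_i F i).
Proof.
move=> F0; apply: (@negligibleS _ _ _ _
    (\bigcup_k if unpickle k is Some i then F i else set0)).
  by move=> x [i _ Fi]; exists (pickle i) => //; rewrite pickleK.
apply: negligible_bigcup => k; case: unpickle => // *.
exact: negligible_set0.
Qed.

Lemma measure0_le_inv (R : realType) d (T : measurableType d)
    (mu : probability T R) (A : set T) (c : R) : measurable A -> 0 < c ->
  (forall j : nat, (mu A <= (c / j.+1%:R)%:E)%E) -> mu A = 0%E.
Proof.
move=> mA c0 Ac; apply/eqP; rewrite eq_le measure_ge0 andbT.
have fA : mu A \is a fin_num by exact: fin_num_measure.
rewrite -(fineK fA) lee_fin leNgt; apply/negP => A0.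
have [j] := ltr_add_invr (divr_gt0 A0 c0).
rewrite add0r ltr_pdivlMr // mulrC => jA.
have := Ac j; rewrite -(fineK fA) lee_fin.
by move=> /(lt_le_trans jA); rewrite ltxx.
Qed.

(** Bundling allows [distribution] to be applied to a function whose
    measurability is a local fact. *)
Definition mfun_of d d' (T : measurableType d) (T' : measurableType d')
    (f : T -> T') (mf : measurable_fun setT f) : {mfun T >-> T'} :=
  HB.pack f (isMeasurableFun.Build _ _ _ _ f mf).

Lemma measurable_diag n (G : Type) d (X : measurableType d) (act : G -> X -> X)
    (g : G) : measurable_fun setT (act g) ->
  measurable_fun setT (@diag n G X act g).
Proof. exact: (@measurable_map_coord n d X id). Qed.

Section power_measure.
Context (R : realType) d (X : measurableType d) (mu : probability X R).

(** By induction on [n]: the image of the product measure under the product of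
    two measure-preserving maps agrees with the product measure on
    rectangles. *)
Lemma power_prob_diag n (G : Type) (act : G -> X -> X) (g : G) :
  measurable_fun setT (act g) ->
  (forall A, measurable A -> mu (act g @^-1` A) = mu A) ->
  forall E, measurable E ->
    power_prob mu n (@diag n G X act g @^-1` E) = power_prob mu n E.
Proof.
move=> mg mug; elim: n => [|n IH] E mE.
  congr (_ _); apply/seteqP; split=> x; rewrite /= (tuple0 x);
  by rewrite (tuple0 (diag act g _)).
rewrite /= /distribution /pushforward.
have mF : measurable (@cons_pair n X @^-1` E).
  exact: measurable_funPTI.
pose f (p : X * n.-tuple X) := (act g p.1, diag act g p.2).
have mf : measurable_fun setT f.
  apply/measurable_fun_pairP; split.
    exact: measurableT_comp mg measurable_fst.
  exact: measurableT_comp (measurable_diag mg) measurable_snd.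
rewrite [RHS](product_measure_unique
    (m' := distribution (mu \x power_prob mu n)%E (mfun_of mf))) //.
  congr ((_ \x _)%E _); apply/seteqP; split=> -[x y] /=;
  (suff -> : cons_pair (f (x, y)) = diag act g (cons_pair (x, y)) by []);
  apply: eq_from_tnth => i; rewrite tnth_mktuple;
  by case: (unliftP ord0 i) => [j ->|->]; rewrite ?tnthS ?tnth_mktuple ?tnth0.
move=> A B mA mB.
have mgA := measurable_preimage mg mA.
have mgB := measurable_preimage (measurable_diag (n := n) mg) mB.
apply: etrans (product_measure1E mu (power_prob mu n) mgA mgB) _.
by congr (_ * _)%E; [exact: mug|exact: IH].
Qed.

Lemma power_prob_coord n (i : 'I_n) (A : set X) : measurable A ->
  power_prob mu n [set x | A (tnth x i)] = mu A.
Proof.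
move=> mA; pose B j := if j == i then A else setT.
rewrite (_ : [set x | _] = [set x | forall j, B j (tnth x j)]).
  rewrite power_probE; last by move=> j; rewrite /B; case: ifP.
  rewrite (bigD1 i) //= {1}/B eqxx big1 ?mule1 // => j /negPf ji.
  by rewrite /B ji probability_setT.
apply/seteqP; split=> x /= => [Ax j|/(_ i)]; rewrite /B; last by rewrite eqxx.
by case: eqP => // ->.
Qed.

Lemma power_prob_coord2 n (i j : 'I_n) (A B : set X) : i != j ->
  measurable A -> measurable B ->
  power_prob mu n [set x | A (tnth x i) /\ B (tnth x j)] = (mu A * mu B)%E.
Proof.
move=> ij mA mB; pose C k := if k == i then A else if k == j then B else setT.
rewrite (_ : [set x | _] = [set x | forall k, C k (tnth x k)]).
  rewrite power_probE; last by move=> k; rewrite /C; do 2 case: ifP => // _.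
  rewrite (bigD1 i) //= (bigD1 j) /=; last by rewrite eq_sym.
  rewrite {1 2}/C eqxx eq_sym (negPf ij) eqxx big1 ?mule1 // => k.
  by move=> /andP[/negPf ki /negPf kj]; rewrite /C ki kj probability_setT.
apply/seteqP; split=> x /=.
  by move=> [Ax Bx] k; rewrite /C; case: eqP => [->//|_]; case: eqP => // ->.
move=> xC; have := xC j; have := xC i; rewrite /C eqxx eq_sym (negPf ij).
by rewrite eqxx.
Qed.

Lemma measurable_diagonal (D : nat -> set X) :
  (forall k, measurable (D k)) -> point_separating D ->
  measurable [set p : X * X | p.1 = p.2].
Proof.
move=> mD sD.
rewrite -[X in measurable X]setCK; apply: measurableC.
rewrite (_ : ~` _ = \bigcup_k (D k `*` ~` D k)).
  apply: bigcup_measurable => k _.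
  by apply: measurableX => //; exact: measurableC.
apply/seteqP; split=> -[x y] /=.
  by move=> /(point_separating_neq sD)[k Dx nDy]; exists k.
by move=> [k _ [/= Dx nDy]] xy; apply: nDy; rewrite -xy.
Qed.

(** Two distinct coordinates are distributed as [mu \x mu], for which the
    diagonal is null by Fubini, its sections being points. *)
Lemma power_prob_coincidence n (i j : 'I_n) (D : nat -> set X) :
  (forall k, measurable (D k)) -> point_separating D ->
  (forall x, mu [set x] = 0%E) -> i != j ->
  measurable [set x : n.-tuple X | tnth x i = tnth x j] /\
  power_prob mu n [set x | tnth x i = tnth x j] = 0%E.
Proof.
move=> mD sD mu0 ij.
have mDelta := measurable_diagonal mD sD.
pose f (x : n.-tuple X) := (tnth x i, tnth x j).
have mf : measurable_fun setT f.
  by apply/measurable_fun_pairP; split; exact: measurable_tnth.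
split.
  exact: measurable_preimage mf mDelta.
apply: etrans (esym (product_measure_unique (m1 := mu) (m2 := mu)
    (m' := distribution (power_prob mu n) (mfun_of mf)) _ mDelta)) _.
  by move=> A B mA mB; rewrite -(power_prob_coord2 ij).
rewrite /product_measure1; apply: integral0_eq => x _ /=.
rewrite (_ : xsection _ x = [set x]) //.
apply/seteqP; split=> y; rewrite /xsection /= inE /=.
  by move=> ->.
by move=> ->.
Qed.

Lemma power_prob_not_injective n (D : nat -> set X) :
  (forall k, measurable (D k)) -> point_separating D ->
  (forall x, mu [set x] = 0%E) ->
  (power_prob mu n).-negligible [set x : n.-tuple X | ~ injective (tnth x)].
Proof.
move=> mD sD mu0.
apply: (@negligibleS _ _ _ _ (\bigcup_(ij : 'I_n * 'I_n)
    [set x : n.-tuple X | ij.1 != ij.2 /\ tnth x ij.1 = tnth x ij.2])).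
  move=> x /= nx; apply: contrapT => ncoinc; apply: nx => i j xij.
  by apply/eqP; apply: contrapT => /negP ij; apply: ncoinc; exists (i, j).
apply: negligible_bigcup_countable => -[i j] /=.
have [->|ij] := eqVneq i j.
  by apply: negligibleS (negligible_set0 _) => x [].
have [mE E0] := power_prob_coincidence mD sD mu0 ij.
by exists [set x : n.-tuple X | tnth x i = tnth x j]; split => // x [].
Qed.

End power_measure.

(** * The induced action and the absence of atoms *)

Section action.
Context (R : realType) (G : groupType) d (X : measurableType d)
  (mu : probability X R) (act : G -> X -> X).
Hypothesis act_mp : mp_action mu act.

Lemma act_inj g : injective (act g).
Proof.
move=> x y /(congr1 (act g^-1%g)).
by rewrite -!(mp_actionM act_mp) mulVg !(mp_action1 act_mp).
Qed.

Lemma mp_action_sym_diag n :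
  mp_action (sym_power_prob mu n) (@sym_diag n G X act).
Proof.
have msym g : measurable_fun setT (@sym_diag n G X act g).
  move=> _ A mA; rewrite setTI /measurable /= /sym_measurable /=.
  rewrite (_ : _ @^-1` _ = diag act g @^-1` (@sym_proj n X @^-1` A)).
    apply: measurable_preimage (measurable_funPTI (@sym_proj n X) mA).
    exact: measurable_diag (mp_action_measurable act_mp g).
  by apply/seteqP; split=> x /=; rewrite sym_diag_proj.
split=> //.
- move=> y; have [x <-] := sym_proj_surj y.
  rewrite sym_diag_proj; congr sym_proj.
  by apply: eq_from_tnth => i; rewrite tnth_mktuple (mp_action1 act_mp).
- move=> g h y; have [x <-] := sym_proj_surj y.
  rewrite !sym_diag_proj; congr sym_proj.
  by apply: eq_from_tnth => i; rewrite !tnth_mktuple (mp_actionM act_mp).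
- move=> g A mA; rewrite /= /distribution /pushforward.
  rewrite -[RHS](@power_prob_diag R d X mu n G act g) //.
  + congr (_ _); apply/seteqP; split=> x /=; by rewrite sym_diag_proj.
  + exact: (mp_action_measurable act_mp g).
  + by move=> B; exact: (mp_action_preserving act_mp).
Qed.

(** If [a] had positive mass, some [g] would have a support differing from
    [{a}] by less than that mass.  Either [g] fixes [a], and the difference
    contains [a]; or [g] moves [a], hence also [act g a], and the difference
    contains this other atom of the same mass. *)
Lemma absolutely_nonfree_nonatomic (D : nat -> set X) :
  (forall k, measurable (D k)) -> point_separating D ->
  absolutely_nonfree mu act -> forall a, mu [set a] = 0%E.
Proof.
move=> mD sD anf a.
have m1 (b : X) : measurable [set b].
  have mpair : measurable_fun setT (fun x : X => (x, b)).
    by apply: (@measurable_fun_pair _ _ _ X X X id (cst b)).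
  have := measurable_preimage mpair (measurable_diagonal mD sD).
  by congr measurable; apply/seteqP; split=> x.
apply: contrapT => /eqP mua0.
have mua_fin : mu [set a] \is a fin_num by exact: fin_num_measure.
have mua_gt0 : (0 < fine (mu [set a]))%R.
  by rewrite fine_gt0// lt0e mua0 measure_ge0 /= ltey_eq mua_fin.
have [g] := anf (~` [set a]) (measurableC (m1 a)) _ mua_gt0.
rewrite fineK // ltNge => /negP; apply.
have mE : measurable (Fix act g `+` ~` [set a]).
  have mFix : measurable (Fix act g).
    rewrite -[Fix _ _]setCK; apply: measurableC.
    exact: measurable_supp mD sD (mp_action_measurable act_mp g).
  by apply: measurableU; apply: measurableD => //; exact: measurableC.
have [ga|ga] := pselect (act g a = a).
  apply: le_measure; rewrite ?inE // => _ ->; left; split=> //.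
  by move=> /(_ erefl).
have <- : mu [set act g a] = mu [set a].
  rewrite -(mp_action_preserving act_mp g); last exact: m1.
  by congr (mu _); apply/seteqP; split=> [x /= /act_inj //|x ->].
apply: le_measure; rewrite ?inE // => _ ->; right; split=> //.
by rewrite /Fix /= => /act_inj.
Qed.

End action.

(** * Sets with infinite local orbits *)

Section local_orbits.
Context (R : realType) (G : groupType) d (X : measurableType d)
  (mu : probability X R) (act : G -> X -> X) (D : nat -> set X).
Hypotheses (act_mp : mp_action mu act) (act_anf : absolutely_nonfree mu act)
  (mD : forall k, measurable (D k)) (sD : point_separating D).

Let mact g : measurable_fun setT (act g) := mp_action_measurable act_mp g.

Lemma measurable_act_supp g : measurable (supp act g).
Proof. exact: measurable_supp mD sD (mact g). Qed.

Lemma measurable_act_Fix g : measurable (Fix act g).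
Proof.
rewrite -[Fix _ _]setCK; apply: measurableC; exact: measurable_act_supp.
Qed.

Lemma local_group_sub (g : G) (A : set X) :
  supp act g `<=` A -> local_group mu act A g.
Proof.
by move=> gA; rewrite /local_group /= (_ : _ `\` _ = set0) ?setD_eq0.
Qed.

(** The support of [g] is measurable because [X] is countably separated, so
    that [mu] is monotone on the sets compared here. *)
Lemma local_groupS (A B : set X) : measurable A -> measurable B -> A `<=` B ->
  local_group mu act A `<=` local_group mu act B.
Proof.
move=> mA mB AB g gA.
apply: (@subset_measure0 _ _ _ mu _ (supp act g `\` A)) => //.
- by apply: measurableD => //; exact: measurable_act_supp.
- by apply: measurableD => //; exact: measurable_act_supp.
- by apply: setDS.
Qed.

(** The set [B] whose points are considered and the set [C] that carries the
    supports are kept apart because the construction enlarges [C] before the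
    new points are taken care of. *)
Definition locally_infinite (B C : set X) :=
  {ae mu, forall x, B x ->
    infinite_set [set act g x | g in local_group mu act C]}.

(** One enlargement: [C] adds to [B] the supports of elements approximating
    [D k `&` B], for each [k] with arbitrarily good precision.  Almost every
    point of [D k `&` B] is then moved inside [D k]. *)
Lemma local_orbit_step (B : set X) (e : R) : measurable B -> 0 < e ->
  exists C, [/\ measurable C, B `<=` C, (mu (C `\` B) <= e%:E)%E &
    locally_infinite B C].
Proof.
move=> mB e0.
(* The pair [(k, j)] coded by [p]: the set to approximate and the precision.
   The factor [2 ^ p.+1] makes the errors summable to [e], the factor [j.+1]
   makes them tend to 0 along each [k]. *)
pose kj p : nat * nat := odflt (0, 0)%N (unpickle p).
pose eps p : R := e / (2 ^ p.+1)%:R / (kj p).2.+1%:R.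
have eps_gt0 p : 0 < eps p by rewrite !divr_gt0 // ltr0n expn_gt0.
have mDB k : measurable (D k `&` B) by exact: measurableI.
have /choice[g gP] : forall p, exists g : G,
    (mu (Fix act g `+` ~` (D (kj p).1 `&` B)) < (eps p)%:E)%E.
  by move=> p; apply: act_anf => //; exact: measurableC.
pose E p := Fix act (g p) `+` ~` (D (kj p).1 `&` B).
have mE p : measurable (E p).
  have mFix := measurable_act_Fix (g p).
  by apply: measurableU; apply: measurableD => //; exact: measurableC.
pose C := B `|` \bigcup_p supp act (g p).
have mC : measurable C.
  by apply: measurableU => //; apply: bigcup_measurable => p _;
    exact: measurable_act_supp.
exists C; split=> //; first exact: subsetUl.
  apply: (@le_trans _ _ (\sum_(0 <= p <oo) mu (E p))%E).
    apply: measure_sigma_subadditive => //; first exact: measurableD.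
    move=> x [[//|[p _ gx]] nBx]; exists p => //; right; split=> //.
    by move=> [].
  apply: le_trans (epsilon_trick0 xpredT (ltW e0)).
  apply: lee_nneseries => // p _; apply: le_trans (ltW (gP p)) _.
  rewrite lee_fin /eps ler_pdivrMr // ler_peMr ?ler1n //.
  by rewrite divr_ge0 // ltW.
(* If [x] is in [D k `&` B] but not in [F k j], then the [j]-th element for
   [k] moves [x] to another point of [D k]. *)
pose F (k j : nat) := let p := pickle (k, j) in E p `|` act (g p) @^-1` E p.
have mF k j : measurable (F k j).
  by apply: measurableU => //; exact: measurable_preimage (mact _) (mE _).
have muF k j : (mu (F k j) <= ((e *+ 2) / j.+1%:R)%:E)%E.
  set p := pickle (k, j); have kjp : kj p = (k, j) by rewrite /kj pickleK.
  have muF2 : (mu (F k j) <= mu (E p) + mu (E p))%E.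
    rewrite -[X in (_ <= _ + X)%E](mp_action_preserving act_mp (g p)) //.
    by apply: measureU2 => //; exact: measurable_preimage (mact _) (mE _).
  apply: le_trans muF2 _.
  have mu_le : (mu (E p) <= (e / j.+1%:R)%:E)%E.
    apply: le_trans (ltW (gP p)) _.
    rewrite lee_fin /eps kjp /= ler_pM2r ?invr_gt0 ?ltr0n //.
    by rewrite ler_pdivrMr ?ltr0n ?expn_gt0 // ler_peMr ?ler1n ?expn_gt0 // ltW.
  by rewrite mulr2n mulrDl EFinD leeD.
have N0 : mu.-negligible (\bigcup_k \bigcap_j F k j).
  apply: negligible_bigcup => k.
  have mFk : measurable (\bigcap_j F k j) by exact: bigcapT_measurable.
  apply/negligibleP => //; apply: measure0_le_inv (mFk) _ _.
    by apply: (_ : 0 < e *+ 2); rewrite pmulrn_lgt0.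
  move=> j; apply: le_trans (muF k j).
  by apply: le_measure; rewrite ?inE // => x; exact.
apply: negligibleS N0 => x /= /not_implyP[Bx /contrapT Ofin].
pose O := [set act h x | h in local_group mu act C] `\ x.
have [k Dx OD] : exists2 k, D k x & forall y, O y -> ~ D k y.
  apply: sD; first exact: finite_setD.
  by move=> [_ /(_ erefl)].
exists k => // j _; apply: contrapT => /not_orP[nE ngE].
set p := pickle (k, j) in nE ngE.
have kjp : kj p = (k, j) by rewrite /kj pickleK.
have gx : act (g p) x <> x.
  move=> gx; apply: nE; left; split=> //=; apply; split => //.
  by rewrite kjp.
have DBgx : (D k `&` B) (act (g p) x).
  apply: contrapT => nDB; apply: ngE; right; rewrite /= kjp; split=> //.
  by rewrite /Fix /= => /(act_inj act_mp).
apply: (OD (act (g p) x)); last by case: DBgx.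
split=> //; exists (g p) => //; apply: local_group_sub.
by move=> z gz; right; exists p.
Qed.

(** Iterating the previous lemma with errors [e / 2 ^ k.+1] and taking the
    union: the points present at stage [k] have infinite orbits under the local
    group of stage [k.+1], a subgroup of the local group of the union. *)
Lemma locally_infinite_hull (B : set X) (e : R) : measurable B -> 0 < e ->
  exists C, [/\ measurable C, B `<=` C, (mu (C `\` B) <= e%:E)%E &
    locally_infinite C C].
Proof.
move=> mB e0.
have /choice[U UP] : forall (A : set X * nat), exists C, measurable A.1 ->
    [/\ measurable C, A.1 `<=` C,
      (mu (C `\` A.1) <= (e / (2 ^ A.2.+1)%:R)%:E)%E & locally_infinite A.1 C].
  move=> [A k] /=; have [mA|nmA] := pselect (measurable A); last by exists A.
  have ek : 0 < e / (2 ^ k.+1)%:R by rewrite divr_gt0 // ltr0n expn_gt0.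
  by have [C CP] := local_orbit_step mA ek; exists C.
pose A := fix A k := if k is k'.+1 then U (A k', k') else B.
have mA k : measurable (A k).
  by elim: k => //= k IH; have [] := UP (A k, k) IH.
have AP k := UP (A k, k) (mA k).
exists (\bigcup_k A k); split.
- exact: bigcup_measurable.
- by move=> x Bx; exists 0%N.
- apply: (@le_trans _ _ (\sum_(0 <= k <oo) mu (A k.+1 `\` A k))%E).
    apply: measure_sigma_subadditive => [k||x [[k _ Akx] nBx]].
    + by apply: measurableD => //; exact: (mA k.+1).
    + by apply: measurableD => //; exact: bigcup_measurable.
    elim: k Akx => [//|k IH Ax].
    have [/IH//|nAx] := pselect (A k x).
    by exists k.
  apply: le_trans (epsilon_trick0 xpredT (ltW e0)).
  by apply: lee_nneseries => // k _; have [] := AP k.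
- have : forall k, {ae mu, forall x, A k x ->
      infinite_set [set act g x | g in local_group mu act (\bigcup_k A k)]}.
    move=> k; have [mC _ _] := AP k; rewrite /locally_infinite.
    apply: filterS => x inf /inf.
    apply: contra_not; apply: sub_finite_set; apply: image_subset.
    apply: local_groupS => //; first exact: bigcup_measurable.
    exact: (@bigcup_sup _ _ k.+1).
  move=> /ae_foralln; apply: filterS => x xinf [k _ Akx].
  exact: xinf Akx.
Qed.

End local_orbits.

(** * Multisets meeting a given set *)

Definition meets n (T : choiceType) (B : set T) : set (sym_power n T) :=
  [set y | exists i, B (tnth (repr y) i)].

Lemma repr_sym_proj n (T : choiceType) (x : n.-tuple T) :
  exists s : 'S_n, repr (sym_proj x) = permute_tuple s x.
Proof. by apply/sym_projP; exact: reprK. Qed.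

Lemma meets_proj n (T : choiceType) (B : set T) (x : n.-tuple T) :
  meets B (sym_proj x) <-> exists i, B (tnth x i).
Proof.
rewrite /meets /=; have [s ->] := repr_sym_proj x; split=> -[i].
  by rewrite tnth_mktuple => Bx; exists (s i).
by move=> Bx; exists ((s^-1)%g i); rewrite tnth_mktuple permKV.
Qed.

Section meets_measure.
Context (R : realType) d (X : measurableType d) (mu : probability X R)
  (n : nat).

Lemma measurable_meets (B : set X) : measurable B ->
  measurable (meets B : set (sym_power n X)).
Proof.
move=> mB; rewrite /measurable /= /sym_measurable /=.
rewrite (_ : _ @^-1` _ = \bigcup_(i in [set: 'I_n]) [set x | B (tnth x i)]).
  apply: fin_bigcup_measurable => [|i _]; first exact: finite_finset.
  exact: measurable_coord.
apply/seteqP; split=> x /=; first by move=> /meets_proj[i Bx]; exists i.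
by move=> [i _ Bx]; apply/meets_proj; exists i.
Qed.

Lemma sym_power_prob_meets (B : set X) (e : R) : measurable B ->
  (mu B <= e%:E)%E -> (sym_power_prob mu n (meets B) <= (n%:R * e)%:E)%E.
Proof.
move=> mB Be; rewrite /= /distribution /pushforward.
have := measurable_meets mB; rewrite {1}/measurable /= /sym_measurable /=.
case: n => [|m] mmeets.
  rewrite (_ : _ @^-1` _ = set0) ?measure0 ?mul0r //.
  by apply/seteqP; split=> x // /meets_proj[[]].
pose F (k : nat) := [set x : m.+1.-tuple X | B (tnth x (inord k))].
have mF k : measurable (F k) by exact: measurable_coord.
apply: (@le_trans _ _ (\sum_(k < m.+1) power_prob mu m.+1 (F k))%E).
  apply: (@content_subadditive _ _ _ (power_prob mu m.+1)) => //.
  rewrite -bigcup_mkord => x /meets_proj[i Bx].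
  by exists i => //=; rewrite /F /= inord_val.
apply: (@le_trans _ _ (\sum_(k < m.+1) e%:E)%E).
  apply: lee_sum => k _; rewrite power_prob_coord //.
by rewrite sumEFin sumr_const card_ord mulr_natl.
Qed.

Lemma sym_power_prob_meets0 (B : set X) : measurable B ->
  mu B = 0%E -> sym_power_prob mu n (meets B) = 0%E.
Proof.
move=> mB B0; apply/eqP; rewrite -measure_le0.
by have := @sym_power_prob_meets B 0 mB; rewrite mulr0 B0; exact.
Qed.

End meets_measure.

Section symmetric_orbits.
Context (R : realType) (G : groupType) d (X : measurableType d)
  (mu : probability X R) (act : G -> X -> X) (n : nat).
Hypotheses (act_mp : mp_action mu act) (X_lebesgue : standard_borel R X).

(** A multiset that avoids [B] and is moved by [g] has a point in the support
    of [g] outside [B]. *)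
Lemma local_group_meets (B : set X) : measurable B ->
  local_group mu act B `<=`
    local_group (sym_power_prob mu n) (@sym_diag n G X act) (meets B).
Proof.
move=> mB g gB.
have [D [mD sD]] := standard_borel_separating X_lebesgue.
have [D' [mD' sD']] :=
  standard_borel_separating (standard_borel_sym_power n X_lebesgue).
have mS : measurable (supp act g) := measurable_act_supp act_mp mD sD g.
have mS' : measurable (supp (@sym_diag n G X act) g).
  exact: (measurable_act_supp (mp_action_sym_diag act_mp n) mD' sD' g).
have mSB : measurable (supp act g `\` B) by exact: measurableD.
apply: (@subset_measure0 _ _ _ _ _ (meets (supp act g `\` B))).
- by apply: measurableD => //; exact: measurable_meets.
- exact: measurable_meets.
- move=> y; have [x <-] := sym_proj_surj y => -[].
  rewrite /supp /= /Fix /= sym_diag_proj => gx nB.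
  apply/meets_proj; apply: contrapT => nS; apply: gx; congr sym_proj.
  apply: eq_from_tnth => i; rewrite tnth_mktuple.
  apply: contrapT => gi; apply: nS; exists i; split=> // Bi.
  by apply: nB; apply/meets_proj; exists i.
- exact: sym_power_prob_meets0.
Qed.

(** Finitely many multisets have finitely many points in total, so a finite
    orbit of a multiset makes the orbits of its points finite. *)
Lemma meets_infinite_orbits (B : set X) : measurable B ->
  locally_infinite mu act B B ->
  {ae sym_power_prob mu n, forall y, meets B y ->
    infinite_set [set sym_diag act g y | g in
      local_group (sym_power_prob mu n) (@sym_diag n G X act) (meets B)]}.
Proof.
move=> mB [N [mN N0 BN]]; exists (meets N); split.
- exact: measurable_meets.
- exact: sym_power_prob_meets0.
move=> y; have [x <-] := sym_proj_surj y => /not_implyP[/meets_proj[i Bx]].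
move=> /contrapT Ofin; apply/meets_proj; exists i; apply: BN => /= /(_ Bx).
apply; set O := (X in finite_set X) in Ofin.
have : finite_set ((fun p : sym_power n X * 'I_n => tnth (repr p.1) p.2) @`
    (O `*` [set: 'I_n])).
  by apply: finite_image; apply: finite_setX => //; exact: finite_finset.
apply: sub_finite_set.
move=> _ [g gB <-]; have [s sE] := repr_sym_proj (diag act g x).
exists (sym_proj (diag act g x), (s^-1)%g i).
  by split=> //; exists g; [exact: local_group_meets|rewrite sym_diag_proj].
by rewrite /= sE !tnth_mktuple permKV.
Qed.

End symmetric_orbits.

(** * Generation of the symmetric sigma-algebra *)

Definition box n (T : Type) (A : 'I_n -> set T) : set (n.-tuple T) :=
  [set x | forall i, A i (tnth x i)].

(** A tuple meeting [n] disjoint sets has exactly one entry in each, which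
    defines a permutation. *)
Lemma sym_proj_box n (T : choiceType) (A : 'I_n -> set T) :
  trivIset [set: 'I_n] A -> @sym_proj n T @` box A = \bigcap_i meets (A i).
Proof.
move=> dA; apply/seteqP; split=> [_ [x Ax <-] i _|y].
  by apply/meets_proj; exists i.
have [x <-] := sym_proj_surj y => xA.
have /choice[f fP] : forall i, exists j, A i (tnth x j).
  by move=> i; have /meets_proj := xA i I.
have finj : injective f.
  move=> i j fij; apply: dA => //; exists (tnth x (f i)).
  by split; [|rewrite fij]; exact: fP.
exists (permute_tuple (perm finj) x); last exact: permute_sym_proj.
by move=> i; rewrite tnth_mktuple permE.
Qed.

Lemma sym_proj_box_inj n (T : choiceType) (A : 'I_n -> set T) :
  trivIset [set: 'I_n] A ->
  forall x y, box A x -> box A y -> sym_proj x = sym_proj y -> x = y.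
Proof.
move=> dA x y Ax Ay /sym_projP[s xy]; rewrite xy.
apply: eq_from_tnth => i; rewrite tnth_mktuple; congr tnth.
apply: dA => //; exists (tnth y (s i)); split; first exact: Ay.
by have := Ax i; rewrite xy tnth_mktuple.
Qed.

(** [S] stands for the sigma-algebra generated by the sets [meets B] and the
    null sets. *)
Section generation.
Context (R : realType) d (X : measurableType d) (mu : probability X R) (n : nat)
  (S : set (set (sym_power n X))) (D : nat -> set X).
Hypotheses (S_sigma : sigma_algebra setT S) (S_meas : S `<=` measurable)
  (S_null : forall N, measurable N -> sym_power_prob mu n N = 0%E -> S N)
  (S_meets : forall B, measurable B -> S (meets B))
  (mD : forall k, measurable (D k)) (sD : point_separating D)
  (mu_nonatomic : forall x, mu [set x] = 0%E).

Let S_bigcup (I : countType) (F : I -> set (sym_power n X)) :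
  (forall i, S (F i)) -> S (\bigcup_i F i).
Proof.
case: S_sigma => S0 SC SU SF.
rewrite (_ : \bigcup_i F i =
    \bigcup_k if unpickle k is Some i then F i else set0).
  by apply: SU => k; case: unpickle.
apply/seteqP; split=> [y [i _ Fi]|y [k _]].
  by exists (pickle i) => //; rewrite pickleK.
by case: unpickle => // i Fi; exists i.
Qed.

Let S_bigcap (I : countType) (F : I -> set (sym_power n X)) :
  (forall i, S (F i)) -> S (\bigcap_i F i).
Proof.
move=> SF; rewrite -[\bigcap_i F i]setCK setC_bigcap -setTD.
case: S_sigma => _ SC _; apply: (SC); apply: S_bigcup => i.
by rewrite -setTD; exact: SC.
Qed.

(** Cutting a box of disjoint sets by a condition on one coordinate gives
    again a box of disjoint sets, so the generators of the sigma-algebra of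
    tuples have good images, and injectivity on the box extends this to all
    measurable sets. *)
Lemma sym_proj_box_generated (A : 'I_n -> set X) (E : set (n.-tuple X)) :
  (forall i, measurable (A i)) -> trivIset [set: 'I_n] A -> measurable E ->
  S (@sym_proj n X @` (E `&` box A)).
Proof.
have S_box (B : 'I_n -> set X) : (forall i, measurable (B i)) ->
    trivIset [set: 'I_n] B -> S (@sym_proj n X @` box B).
  move=> mB dB; rewrite sym_proj_box //; apply: S_bigcap => i.
  exact: S_meets.
move=> mA dA /measurable_tuple_gen; apply: sigma_algebra_image_inj => //.
- exact: sym_proj_box_inj.
- exact: S_box.
move=> _ [i [B [mB ->]]].
rewrite (_ : _ `&` _ = box (fun j => if j == i then A j `&` B else A j)).
  apply: S_box => [j|j k _ _ [x [xj xk]]].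
    by case: ifP => // _; exact: measurableI.
  apply: dA => //; exists x.
  by split; [move: xj|move: xk]; case: ifP => // _ [].
apply/seteqP; split=> x /=.
  by move=> [Bx Ax] j; case: eqP => // ji; split=> //; rewrite ji.
move=> xA; split; first by have := xA i; rewrite eqxx => -[].
by move=> j; have := xA j; case: ifP => // _ [].
Qed.

(** The multisets with distinct points are covered by the countably many boxes
    [A k], and the remaining ones are null. *)
Lemma sym_measurable_generated (Z : set (sym_power n X)) : measurable Z -> S Z.
Proof.
move=> mZ.
(* Removing the other sets makes the box disjoint without losing a tuple [x]
   of distinct points, if [D (k i)] isolates the [i]-th entry of [x]. *)
pose A (k : {ffun 'I_n -> nat}) i :=
  D (k i) `\` \bigcup_(j in [set j | j != i]) D (k j).
have mA k i : measurable (A k i).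
  apply: measurableD => //; apply: fin_bigcup_measurable => //.
  exact: finite_finset.
have dA k : trivIset [set: 'I_n] (A k).
  move=> i j _ _ [x [[Dix nDi] [Djx nDj]]].
  apply/eqP; apply: contrapT => /negP ij.
  by apply: nDj; exists i.
pose W := \bigcup_k (@sym_proj n X @` (@sym_proj n X @^-1` Z `&` box (A k))).
have SW : S W.
  apply: S_bigcup => k; apply: sym_proj_box_generated => //.
have WZ : W `<=` Z by move=> _ [k _ [x [Zx _] <-]].
have mZW : measurable (Z `\` W) by apply: measurableD => //; exact: S_meas.
have -> : Z = \bigcup_(b : bool) (if b then W else Z `\` W).
  apply/seteqP; split=> [y Zy|y [[] _ //]]; last first.
  - by case.
  - exact: WZ.
  by have [Wy|nWy] := pselect (W y); [exists true|exists false].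
apply: S_bigcup => -[//|]; apply: S_null => //.
apply: (measure_negligible (mu := power_prob mu n)
  (A := @sym_proj n X @^-1` (Z `\` W))) => //.
apply: negligibleS (power_prob_not_injective n mD sD mu_nonatomic).
move=> x [/= Zx nWx] xinj; apply: nWx.
have /choice[k kP] : forall i, exists k, D k (tnth x i) /\
    forall j, j != i -> ~ D k (tnth x j).
  move=> i; have [|k Dk nDk] := sD (x := tnth x i)
      (finite_image (tnth x) (@finite_finset 'I_n [set j | j != i])).
    by move=> [j /= ji /xinj jE]; rewrite jE eqxx in ji.
  by exists k; split=> // j ji; apply: nDk; exists j.
exists [ffun i => k i] => //; exists x => //; split=> // i.
rewrite /A ffunE; split; first exact: (kP i).1.
move=> [j /= ji]; rewrite ffunE; apply: (kP j).2.
by rewrite eq_sym.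
Qed.

End generation.

Theorem theorem14 (R : realType) (G : groupType) (d : measure_display)
    (X : measurableType d) (mu : probability X R) (act : G -> X -> X)
    (G_countable : countable [set: G])
    (X_lebesgue : standard_borel R X)
    (act_mp : mp_action mu act)
    (act_anf : absolutely_nonfree mu act)
    (n : nat) (n_ge1 : (1 <= n)%N) :
  perfectly_nonfree (sym_power_prob mu n) (@sym_diag n G X act).
Proof.
have [D [mD sD]] := standard_borel_separating X_lebesgue.
split=> //.
- exact: standard_borel_sym_power.
- exact: mp_action_sym_diag.
exists [set A | exists B,
  [/\ measurable B, locally_infinite mu act B B & A = meets B]].
set F := (X in X `<=` _).
have Fm : F `<=` measurable by move=> _ [B [mB _ ->]]; exact: measurable_meets.
split=> //; last by move=> _ [B [mB infB ->]]; exact: meets_infinite_orbits.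
set S := <<s _ >>.
have S_sigma : sigma_algebra setT S by exact: smallest_sigma_algebra.
have S_meas : S `<=` measurable.
  apply: smallest_sub; first exact: sigma_algebra_measurable.
  by move=> A [/Fm//|[]].
have S_null N : measurable N -> sym_power_prob mu n N = 0%E -> S N.
  by move=> mN N0; apply: sub_sigma_algebra; right.
apply/seteqP; split=> //.
apply: (sym_measurable_generated S_sigma S_meas S_null _ mD sD); last first.
  exact: absolutely_nonfree_nonatomic act_anf.
move=> B mB.
(* [meets B] is the intersection of the members [meets (C k)] of the family up
   to a null set, as [C k] contains [B] and exceeds it by at most [1 / k.+1]. *)
have /choice[C CP] : forall k : nat, exists C, [/\ measurable C, B `<=` C,
    (mu (C `\` B) <= (k.+1%:R^-1)%:E)%E & locally_infinite mu act C C].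
  by move=> k; apply: (locally_infinite_hull act_mp act_anf mD sD).
pose Z := \bigcap_k (meets (C k) : set (sym_power n X)).
have SZ : S Z.
  apply: (@bigcapT_measurable _ (g_sigma_algebraType _)) => k.
  apply: sub_sigma_algebra; left; exists (C k).
  by have [mC _ _ infC] := CP k.
have mZB : measurable (Z `\` meets B).
  by apply: measurableD; [exact: S_meas|exact: measurable_meets].
have -> : meets B = Z `\` (Z `\` meets B).
  rewrite setDD setIidr // => y [i Bi] k _.
  by exists i; have [_ BC _ _] := CP k; exact: BC.
apply: (@measurableD _ (g_sigma_algebraType _)) => //.
apply: S_null => //; apply: (measure0_le_inv mZB (c := n%:R)).
  by rewrite ltr0n.
move=> k; have [mC _ Ck _] := CP k.
apply: le_trans (sym_power_prob_meets n (measurableD mC mB) Ck).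
apply: le_measure; rewrite ?inE //.
  by apply: measurable_meets; exact: measurableD.
move=> y [Zy nBy]; have [i Ci] := Zy k I; exists i; split=> // Bi.
by apply: nBy; exists i.
Qed.
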